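(* Let $R>1$ and $A_R=\{z\in\mathbb{C}:\frac1R<|z|<R\}$. Then the density $m_{A_R}$ is given by $$m_{A_R}(z)=\begin{cases}\dfrac{2R^3}{(R|z|-1)(2R^2-R|z|+1)}, & \text{if } \dfrac1R<|z|\le\dfrac{1+R^2}{2R},\\[3mm] \dfrac{2R}{R^2-|z|^2}, & \text{if } \dfrac{1+R^2}{2R}\le|z|<R.\end{cases}$$
   Context: For a bounded domain $D\subset\mathbb{C}$, $\delta_D(z)=\inf\{|z-\xi|:\xi\in\partial D\}$ for $z\in D$, $d(D)=\sup\{|x-y|:x,y\in D\}$, and the density is $$m_D(z)=\frac{d(D)}{\delta_D(z)\,(d(D)-\delta_D(z))}.$$ *)

(* Defs.v *)
From HB Require Import structures.
From mathcomp Require Import all_boot all_order all_algebra complex.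
From mathcomp Require Import all_classical all_reals all_analysis.

Set Implicit Arguments.
Unset Strict Implicit.
Unset Printing Implicit Defensive.

Import Order.TTheory GRing.Theory Num.Theory numFieldNormedType.Exports.
Import ComplexField.Normc.

Local Open Scope classical_set_scope.
Local Open Scope ring_scope.
Local Open Scope complex_scope.

(* The modulus of a complex number is taken as the real number [normc z],
   since the generic norm [`|z|] on [K[i]] has values in [K[i]].
   The functions below are total; they have their usual meaning when [D] is
   a bounded domain and [z] is a point of [D]. *)

(* The type [K[i]^o] carries the norm topology of [K[i]]. *)
Definition boundary (K : realType) (D : set K[i]) : set K[i] :=
  closure (D : set K[i]^o) `\` interior (D : set K[i]^o).

Definition boundary_dist (K : realType) (D : set K[i]) (z : K[i]) : K :=
  inf [set normc (z - xi) | xi in boundary D].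

Definition diameter (K : realType) (D : set K[i]) : K :=
  sup [set normc (x - y) | x in D & y in D].

Definition density (K : realType) (D : set K[i]) (z : K[i]) : K :=
  diameter D / (boundary_dist D z * (diameter D - boundary_dist D z)).

Definition annulus (K : realType) (R : K) : set K[i] :=
  [set z | R^-1 < normc z < R].

(* Main.v *)
Require Import Defs.
From mathcomp Require Import all_boot all_order all_algebra complex.
From mathcomp Require Import all_classical all_reals all_analysis.
From mathcomp Require Import ring lra.
Import Order.TTheory GRing.Theory Num.Theory.
Import ComplexField.Normc.
Import numFieldNormedType.Exports.
Local Open Scope ring_scope.
Local Open Scope complex_scope.

(** Write [r] for the modulus of [z].  The annulus has diameter [2 * R]: the
    triangle inequality bounds the distance of two of its points by [2 * R],
    and the antipodal points [s] and [- s] with [s] close to [R] show that the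
    bound is sharp ([diameter_annulus]).  Its boundary is made of the circles
    of radii [R^-1] and [R], so that the distance from [z] to it is the smaller
    of [r - R^-1] and [R - r] ([boundary_dist_annulus]): the reverse triangle
    inequality gives the lower bound, and the points of the two circles on the
    ray through [z] attain it.  The two numbers are equal for
    [r = (1 + R ^+ 2) / (2 * R)], which is where the formula for the density
    changes.  *)

(** * The modulus *)

Lemma normc_norm (K : realType) (z : K[i]) : `|z| = (normc z)%:C.
Proof. by []. Qed.

(** [le_normcD] and [normcN] are about [Rcomplex K], that is [K[i]] seen as a
    real vector space; the next lemmas use the operations of [K[i]]. *)
Lemma le_normc_add (K : realType) (x y : K[i]) :
  normc (x + y) <= normc x + normc y.
Proof. exact: le_normcD. Qed.

Lemma le_normc_sub (K : realType) (x y : K[i]) :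
  normc (x - y) <= normc x + normc y.
Proof. by rewrite -[normc y](normcN y); exact: le_normcD. Qed.

Lemma normc_distC (K : realType) (x y : K[i]) : normc (x - y) = normc (y - x).
Proof. by rewrite -[x - y]opprB; exact: normcN. Qed.

Lemma le_dist_normc (K : realType) (x y : K[i]) :
  `|normc x - normc y| <= normc (x - y).
Proof.
have Hx := le_normc_add K (x - y) y; have Hy := le_normc_add K (y - x) x.
rewrite !subrK (normc_distC _ y x) in Hx Hy.
by rewrite ler_norml; apply/andP; split; lra.
Qed.

Lemma normc_real (K : realType) (t : K) : normc (t%:C) = `|t|.
Proof. by rewrite /normc /= expr0n addr0 sqrtr_sqr. Qed.

(** Rescaling [z] to modulus [s] moves it radially. *)
Lemma exists_normc_eq_dist (K : realType) (z : K[i]) (s : K) :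
  0 < normc z -> 0 <= s ->
  exists2 w : K[i], normc w = s & normc (z - w) = `|normc z - s|.
Proof.
move=> z0 s0; exists (z * (s / normc z)%:C).
  rewrite normcM normc_real ger0_norm ?divr_ge0 ?(ltW z0) //.
  by rewrite mulrCA divff ?gt_eqF // mulr1.
have -> : z - z * (s / normc z)%:C = z * ((normc z - s) / normc z)%:C.
  by rewrite mulrBl divff ?gt_eqF // rmorphB rmorph1 mulrBr mulr1.
by rewrite normcM normc_real normrM normfV (gtr0_norm z0) mulrCA divff
           ?gt_eqF // mulr1.
Qed.

(** The topology used for [boundary] is the one defined by the modulus, with
    radii in the real field. *)
Lemma nbhs_normcP (K : realType) (z : K[i]) (B : set K[i]) :
  nbhs (z : K[i]^o) B <->
  exists2 e : K, 0 < e & forall w, normc (z - w) < e -> B w.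
Proof.
split.
  move=> /nbhs_normP[e /= e0 eB].
  case: e e0 eB => a b; rewrite ltcE /= => /andP[/eqP -> a0] eB.
  by exists a => // w zw; apply: eB; rewrite /= normc_norm ltcR.
move=> [e e0 eB]; apply/(nbhs_normP (z : K[i]^o)); exists e%:C => /=; first by rewrite ltcR.
by move=> w /=; rewrite normc_norm ltcR; exact: eB.
Qed.

(** * The boundary of the annulus *)

Lemma boundary_annulus_sub (K : realType) (R : K) (xi : K[i]) :
  boundary (annulus R) xi -> ~~ (R^-1 < normc xi < R).
Proof.
move=> [_ nint]; apply/negP => /andP[lo hi]; apply: nint.
apply/nbhs_normcP; exists (Num.min (normc xi - R^-1) (R - normc xi)).
  by rewrite lt_min !subr_gt0 lo hi.
move=> w; have := le_dist_normc _ xi w.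
rewrite ler_norml /annulus /= lt_min => /andP[? ?] /andP[? ?].
by apply/andP; split; lra.
Qed.

Lemma circles_sub_boundary_annulus (K : realType) (R : K) (xi : K[i]) :
  1 < R -> normc xi = R^-1 \/ normc xi = R -> boundary (annulus R) xi.
Proof.
move=> R1 xiE.
have R0 : 0 < R by lra.
have V0 : 0 < R^-1 by rewrite invr_gt0.
have VR : R^-1 < 1 by rewrite invf_lt1.
split; last first.
  move=> /interior_subset /=; rewrite /annulus /=.
  by case: xiE => ->; rewrite ltxx ?andbF.
move=> B /nbhs_normcP[e e0 eB].
(* a modulus inside the annulus at distance less than [e] from that of [xi] *)
have [s sR sxi] : exists2 s : K, R^-1 < s < R & `|normc xi - s| < e.
  pose m := Num.min (e / 2) ((R - R^-1) / 2).
  have m0 : 0 < m by rewrite lt_min; apply/andP; split; lra.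
  have me : m <= e / 2 by rewrite ge_min lexx.
  have mR : m <= (R - R^-1) / 2 by rewrite ge_min lexx orbT.
  case: xiE => ->; [exists (R^-1 + m)|exists (R - m)].
  - by apply/andP; split; lra.
  - by rewrite ltr_norml; apply/andP; split; lra.
  - by apply/andP; split; lra.
  - by rewrite ltr_norml; apply/andP; split; lra.
have xi0 : 0 < normc xi by case: xiE => ->.
have s0 : 0 <= s by lra.
have [w ws wxi] := exists_normc_eq_dist _ _ _ xi0 s0.
by exists w; split; [rewrite /annulus /= ws | apply: eB; rewrite wxi].
Qed.

Lemma boundary_dist_annulus (K : realType) (R : K) (z : K[i]) :
  1 < R -> R^-1 < normc z < R ->
  boundary_dist (annulus R) z = Num.min (normc z - R^-1) (R - normc z).
Proof.
move=> R1 /andP[lo hi].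
have R0 : 0 < R by lra.
have V0 : 0 < R^-1 by rewrite invr_gt0.
have z0 : 0 < normc z by lra.
set d := Num.min _ _.
have dlb : lbound [set normc (z - xi) | xi in boundary (annulus R)]%classic d.
  move=> _ [xi /boundary_annulus_sub xiR <-].
  have := le_dist_normc _ z xi; rewrite ler_norml => /andP[? ?].
  move: xiR; rewrite negb_and -!leNgt /d ge_min => /orP[?|?].
    by apply/orP; left; lra.
  by apply/orP; right; lra.
have circle c : c = R^-1 \/ c = R ->
    [set normc (z - xi) | xi in boundary (annulus R)]%classic `|normc z - c|.
  move=> cE; have c0 : 0 <= c by case: cE => ->; exact: ltW.
  have [xi xiE dE] := exists_normc_eq_dist _ _ _ z0 c0.
  exists xi => //; apply: circles_sub_boundary_annulus => //.
  by rewrite xiE.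
apply/eqP; rewrite eq_le; apply/andP; split; last first.
  by apply: lb_le_inf => //; eexists; exact: (circle R (or_intror erefl)).
have lbd : has_lbound [set normc (z - xi) | xi in boundary (annulus R)]%classic.
  by exists d.
rewrite le_min; apply/andP; split.
  rewrite -[leRHS]gtr0_norm ?subr_gt0 //.
  by apply: (ge_inf lbd); apply: circle; left.
rewrite -[leRHS]gtr0_norm ?subr_gt0 // distrC.
by apply: (ge_inf lbd); apply: circle; right.
Qed.

(** * The diameter of the annulus *)

Lemma diameter_annulus (K : realType) (R : K) :
  1 < R -> diameter (annulus R) = 2 * R.
Proof.
move=> R1.
have R0 : 0 < R by lra.
have V0 : 0 < R^-1 by rewrite invr_gt0.
have VR : R^-1 < 1 by rewrite invf_lt1.
rewrite /diameter; set D := (X in sup X).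
have ubD : ubound D (2 * R).
  move=> _ [x /andP[_ xR] [y /andP[_ yR] <-]].
  by have := le_normc_sub _ x y; lra.
have antipodal s : R^-1 < s < R -> D (2 * s).
  move=> /andP[s1 s2]; have s0 : 0 < s by lra.
  exists s%:C; first by rewrite /annulus /mkset normc_real gtr0_norm // s1.
  exists (- s)%:C.
    by rewrite /annulus /mkset normc_real normrN gtr0_norm // s1.
  by rewrite -rmorphB opprK normc_real gtr0_norm; lra.
have one : D (2 * 1) by apply: antipodal; rewrite VR.
apply/eqP; rewrite eq_le; apply/andP; split.
  by apply: ge_sup => //; exists (2 * 1).
have hubD : has_ubound D by exists (2 * R).
have sup1 := ub_le_sup hubD one.
rewrite leNgt; apply/negP => supR.
(* half-way between [sup D / 2 >= 1] and [R], so still in the annulus *)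
have /antipodal/(ub_le_sup hubD) : R^-1 < (sup D / 2 + R) / 2 < R.
  by apply/andP; split; lra.
lra.
Qed.

(** * The density of the annulus *)

Theorem corollary3p2 (K : realType) (R : K) (hR : 1 < R) (z : K[i]) :
  (R^-1 < normc z <= (1 + R ^+ 2) / (2 * R) ->
     density (annulus R) z
     = 2 * R ^+ 3 / ((R * normc z - 1) * (2 * R ^+ 2 - R * normc z + 1)))
  /\
  ((1 + R ^+ 2) / (2 * R) <= normc z < R ->
     density (annulus R) z = 2 * R / (R ^+ 2 - normc z ^+ 2)).
Proof.
have R0 : 0 < R by lra.
have V0 : 0 < R^-1 by rewrite invr_gt0.
have VR : R^-1 < 1 by rewrite invf_lt1.
have -> : (1 + R ^+ 2) / (2 * R) = (R^-1 + R) / 2.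
  by field; rewrite gt_eqF.
split=> /andP[lo hi]; rewrite /density diameter_annulus //
  boundary_dist_annulus //; try by apply/andP; split; lra.
- rewrite min_l; last by lra.
  have RV : R * R^-1 = 1 by rewrite divff ?gt_eqF.
  have n1 : R * normc z - 1 != 0.
    by rewrite gt_eqF // subr_gt0 -RV ltr_pM2l.
  have n2 : 2 * R ^+ 2 - R * normc z + 1 != 0.
    have : R * normc z < R * R by rewrite ltr_pM2l //; lra.
    by move=> ?; rewrite gt_eqF // expr2; nra.
  field.
  by rewrite n1 n2 gt_eqF.
- rewrite min_r; last by lra.
  congr (_ / _); ring.
Qed.
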